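(* Let $k\ge 2$, let $a \colon \mathbb{N}_0 \to \mathbb{C}$ be a $k$-automatic sequence, and let $p \in \mathbb{R}[x]$ be a polynomial with at least one irrational coefficient other than the constant term. Then $$\lim_{N\to\infty} \mathbb{E}_{n<N}\, a(n)\, e(p(n)) = 0.$$
   Context: $\mathbb{N}_0=\{0,1,2,\dots\}$, $\mathbb{E}_{n<N}\,x(n)=\frac1N\sum_{n=0}^{N-1}x(n)$, $e(\theta)=e^{2\pi i\theta}$. For an integer $k\ge 2$ let $\Sigma_k=\{0,\dots,k-1\}$ and let $\Sigma_k^*$ be the set of finite words over $\Sigma_k$ (including the empty word). For $n\in\mathbb{N}_0$, $(n)_k\in\Sigma_k^*$ is the base-$k$ expansion of $n$ without leading zeros, most significant digit on the left ($(0)_k$ is the empty word). A $k$-automaton $(S,s_0,\delta,\tau)$ consists of a finite set of states $S$, an initial state $s_0\in S$, a transition function $\delta\colon S\times\Sigma_k\to S$ and an output function $\tau\colon S\to\Delta$. Extend $\delta$ to $S\times\Sigma_k^*$ by $\delta(s,\text{empty word})=s$ and $\delta(s,uv)=\delta(\delta(s,v),u)$ (so the rightmost digit is read first). A sequence $a\colon\mathbb{N}_0\to\Delta$ is $k$-automatic if $a(n)=\tau(\delta(s_0,(n)_k))$ for some $k$-automaton. *)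

(* Defs.v *)
From mathcomp Require Import all_boot all_order all_algebra.
From mathcomp Require Import complex.
From mathcomp Require Import all_classical all_reals all_analysis.
Import Order.TTheory GRing.Theory Num.Theory numFieldNormedType.Exports.

Set Implicit Arguments.
Unset Strict Implicit.
Unset Printing Implicit Defensive.

Local Open Scope ring_scope.
Local Open Scope complex_scope.

(* For 1 < k the value [fuel] = n always suffices (see [digits_value]); the
   most significant digit is at the head of the list, and 0 has no digits. *)
Fixpoint digits_rec (k fuel n : nat) : seq nat :=
  if fuel is f.+1 then
    if n == 0%N then [::] else rcons (digits_rec k f (n %/ k)) (n %% k)%N
  else [::].

Definition digits (k n : nat) : seq nat := digits_rec k n n.

(* [pmap insub] only moves the digits from nat to 'I_k; nothing is dropped
   when 1 < k (see [val_expansion]). *)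
Definition expansion (k n : nat) : seq 'I_k := pmap insub (digits k n).

Record automaton (k : nat) (D : Type) := Automaton {
  state : finType;
  init : state;
  trans : state -> 'I_k -> state;
  output : state -> D
}.

(* [foldr] reads the rightmost letter first:
   run s (u :: v) = trans (run s v) u. *)
Definition run (k : nat) (D : Type) (A : automaton k D) (s : state A)
    (w : seq 'I_k) : state A :=
  foldr (fun d s' => trans s' d) s w.

Definition automatic (k : nat) (D : Type) (a : nat -> D) : Prop :=
  exists A : automaton k D,
    forall n, a n = output (run (init A) (expansion k n)).

Definition e (R : realType) (t : R) : R[i] :=
  cos (2 * pi * t) +i* sin (2 * pi * t).

(* The value at N = 0 is the junk value 0. *)
Definition average (K : fieldType) (x : nat -> K) (N : nat) : K :=
  N%:R^-1 * \sum_(n < N) x n.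

Section ExpansionFacts.
Local Open Scope nat_scope.
Variable k : nat.
Hypothesis k_gt1 : 1 < k.

Lemma digits_rec_value f n : n <= f ->
  foldl (fun m d => m * k + d) 0 (digits_rec k f n) = n.
Proof.
elim: f n => [|f IHf] n /=; first by rewrite leqn0 => /eqP.
have [->//|n0] := eqVneq n 0 => le_nf.
rewrite foldl_rcons IHf -?divn_eq // -ltnS (leq_trans _ le_nf)//.
by rewrite ltn_Pdiv // lt0n.
Qed.

Lemma digits_value n : foldl (fun m d => m * k + d) 0 (digits k n) = n.
Proof. exact: digits_rec_value. Qed.

Lemma val_expansion n : map val (expansion k n) = digits k n.
Proof.
rewrite /expansion pmap_filter; last by move=> x; rewrite insubK.
apply/all_filterP; rewrite /digits; move: {1}n => f.
elim: f n => //= f IHf n.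
case: ifP => // _; rewrite all_rcons IHf andbT.
by rewrite isSome_insub ltn_mod ltnW.
Qed.

Lemma digits_rec_head f n : n <= f -> head 1 (digits_rec k f n) != 0.
Proof.
elim: f n => [|f IHf] n //=; have [//|n0] := eqVneq n 0 => le_nf.
have lt_nf : n %/ k <= f.
  by rewrite -ltnS (leq_trans _ le_nf)// ltn_Pdiv // lt0n.
have := IHf _ lt_nf; have := digits_rec_value lt_nf.
case: (digits_rec k f (n %/ k)) => [|d s] //= nk0 _.
by apply: contra n0 => /eqP nmod; rewrite (divn_eq n k) -nk0 nmod.
Qed.

Lemma digits_head n : head 1 (digits k n) != 0.
Proof. exact: digits_rec_head. Qed.

End ExpansionFacts.

(* Main.v *)
Require Import Defs.
From mathcomp Require Import all_boot all_order all_algebra.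
From mathcomp Require Import complex.
From mathcomp Require Import all_classical all_reals all_analysis.
From mathcomp Require Import ring lra zify.
Import Order.TTheory GRing.Theory Num.Theory numFieldNormedType.Exports.

Set Implicit Arguments.
Unset Strict Implicit.
Unset Printing Implicit Defensive.

Local Open Scope classical_set_scope.
Local Open Scope ring_scope.
Local Open Scope complex_scope.

(** The residue classes modulo a power of k split an automatic sequence into
    members of a finite family (its kernel), whose size does not depend on the
    power. On the other side, the phases e(p(n)) split into functions that are
    asymptotically orthogonal. By Bessel's inequality, a bounded sequence
    correlates with few of many almost orthogonal functions; as there are only
    finitely many sequences to test, the correlation of the automatic sequence
    with e(p(n)) is small.

    Let d + 1 be the largest index of an irrational coefficient of p.

    If d > 0, split n = K m + r with K a power of k. The functions
    m |-> e(p(K m + r)), for r < K, are asymptotically orthogonal because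
    p(K x + r) - p(K x + r') again has an irrational coefficient, now with
    largest index d, so that induction applies with the constant sequence 1 as
    the automatic one (mean_zero_orthogonal, irrational_affine_diff,
    mean_zero_poly).

    If d = 0, these differences are constant up to a periodic function, and
    another orthogonal system is needed. The rational coefficients only
    contribute a periodic factor, whose product with an automatic sequence has
    a finite kernel again (rational_poly_period, kernel_closed_twist); so let
    p(n) = alpha n with alpha irrational. Splitting off the last l digits turns
    the frequency alpha into k^l alpha, and these frequencies are distinct
    modulo 1. To use them at once they must be tested on the same interval:
    the range of summation is cut into windows of length k^t, on which the
    sequence is a combination of finitely many indicators (which state is
    reached after t digits), independent of the window. Bessel's inequality for
    l < L bounds the mean by a constant times L^(-1/2) (norm_sum_two_windows,
    mean_zero_linear). *)

(** * The additive character and mean values *)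

Section Character.
Variable R : realType.
Implicit Types t u : R.

Lemma eD t u : e (t + u) = e t * e u.
Proof.
by rewrite /e mulrDr cosD sinD [X in _ +i* X]addrC.
Qed.

Lemma e0 : e (0 : R) = 1.
Proof. by rewrite /e mulr0 cos0 sin0. Qed.

Lemma conj_e t : (e t)^*%R = e (- t).
Proof. by rewrite /e mulrN cosN sinN. Qed.

Lemma norm_e t : `|e t| = 1.
Proof. by apply/eqP; rewrite -sqrp_eq1 // normCK conj_e -eD subrr e0. Qed.

Lemma e_nat (n : nat) : e (n%:R : R) = 1.
Proof.
elim: n => [|n IHn]; first exact: e0.
rewrite -natr1 eD IHn mul1r /e mulr1 -[2 * pi]/(2%:R * pi) mulr_natl.
by rewrite cos2pi sin2pi.
Qed.

Lemma e_int (z : int) : e (z%:~R : R) = 1.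
Proof.
case: z => n; first exact: e_nat.
by rewrite NegzE mulrNz -conj_e e_nat rmorph1.
Qed.

(** With u the fractional part of t, cos (2 pi u) = 1 - 2 sin^2 (pi u), and
    the sine is positive on the open interval from 0 to pi. *)
Lemma e_eq1_int t : e t = 1 -> exists z : int, t = z%:~R.
Proof.
move=> et1; exists (Num.floor t).
set u := t - (Num.floor t)%:~R.
have /andP[u_ge0 u_lt1] : 0 <= u < 1.
  have /andP[h1 h2] := floor_itv t.
  rewrite /u subr_ge0 h1 /= ltrBlDr; rewrite intrD in h2.
  by rewrite addrC.
have eu1 : e u = 1 by rewrite /u eD et1 mul1r -conj_e e_int rmorph1.
have cosu : cos (2 * pi * u) = 1 by case: eu1.
have sin0u : sin (pi * u) = 0.
  have : cos ((pi * u) *+ 2) = 1 by rewrite -cosu -mulrA mulr_natl.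
  rewrite cos_mulr2n => h; have := cos2Dsin2 (pi * u) => h2.
  by apply/eqP; rewrite -sqrf_eq0; apply/eqP; lra.
apply/eqP; rewrite -subr_eq0 -/u; apply/contraT => u_neq0.
have u_gt0 : 0 < u by rewrite lt_neqAle eq_sym u_neq0.
suff : 0 < sin (pi * u) by rewrite sin0u ltxx.
by apply: sin_gt0_pi; rewrite mulr_gt0 ?pi_gt0//= gtr_pMr ?pi_gt0.
Qed.

End Character.

Section Means.
Variable R : realType.
Local Notation C := R[i].
Implicit Types (x g : nat -> C) (N K T : nat).

(** The averages of x tend to 0, with thresholds 1 / T and denominators
    cleared, so that all the estimates below are free of divisions. *)
Definition mean_zero x := forall T, (0 < T)%N ->
  \forall N \near \oo, T%:R * `|\sum_(n < N) x n| <= N%:R.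

Lemma norm_sum_le1 (I : finType) (F : I -> C) :
  (forall i, `|F i| <= 1) -> `|\sum_i F i| <= #|I|%:R.
Proof.
move=> F1; apply: le_trans (ler_norm_sum _ _ _) _.
by rewrite -sum1_card natr_sum ler_sum.
Qed.

Lemma complex_le_nat (z : C) : exists M : nat, `|z| <= M%:R.
Proof.
exists (Num.truncn (complex.Re `|z|)).+1.
have -> : `|z| = (complex.Re `|z|)%:C by apply/esym/RRe_real/normr_real.
rewrite -[_%:R](rmorph_nat (@real_complex R)) lecR.
exact/ltW/truncnS_gt.
Qed.

Lemma mean_zeroZ (c : C) x : mean_zero x -> mean_zero (fun n => c * x n).
Proof.
move=> x0 T T0; have [M cM] := complex_le_nat c.
have TM0 : (0 < T * M.+1)%N by rewrite muln_gt0 T0.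
apply: filterS (x0 _ TM0) => N; apply: le_trans.
rewrite -mulr_sumr normrM mulrA ler_wpM2r// natrM ler_wpM2l//.
by apply: le_trans cM _; rewrite ler_nat.
Qed.

Lemma sum_residues K N g :
  \sum_(n < K * N) g n = \sum_(r < K) \sum_(m < N) g (K * m + r)%N.
Proof.
elim: N => [|N IHN].
  by rewrite muln0 big_ord0 big1 // => r _; rewrite big_ord0.
rewrite mulnS addnC big_split_ord /= IHN -big_split /=.
by apply: eq_bigr => r _; rewrite big_ord_recr.
Qed.

(** The last incomplete block of length K is negligible. *)
Lemma mean_zero_blocks g : (forall n, `|g n| <= 1) ->
  (forall T, (0 < T)%N -> exists2 K, (0 < K)%N &
     \forall N \near \oo, T%:R * `|\sum_(n < K * N) g n| <= (K * N)%:R) ->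
  mean_zero g.
Proof.
move=> g1 blocks T T0.
(* Half of the allowance is for the last block. *)
have [|K K0 [N0 _ hN0]] := blocks (2 * T)%N; first by rewrite muln_gt0.
near=> N.
have N0N : (N0 <= N %/ K)%N.
  by rewrite leq_divRL //; near: N; exact: nbhs_infty_ge.
have NTK : (2 * T * K <= N)%N by near: N; exact: nbhs_infty_ge.
have := hN0 _ N0N.
have -> : \sum_(n < N) g n = \sum_(n < K * (N %/ K)) g n
   + \sum_(i < N %% K) g (K * (N %/ K) + i)%N.
  by rewrite [in LHS](divn_eq N K) [(_ %/ _ * _)%N]mulnC big_split_ord.
set A := \sum_(n < _) _; set B := \sum_(n < _) _ => hA.
have hB : `|B| <= K%:R.
  apply: le_trans (norm_sum_le1 _) _ => //.
  by rewrite card_ord ler_nat ltnW ?ltn_mod.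
rewrite -(ler_pM2l (ltr0n _ 2)) mulrA -natrM.
apply: le_trans (ler_wpM2l (ler0n _ _) (ler_normD _ _)) _.
rewrite mulrDr [_ * N%:R]mulr_natl mulr2n lerD //.
  by apply: le_trans hA _; rewrite ler_nat mulnC leq_divM.
by apply: le_trans (ler_wpM2l (ler0n _ _) hB) _; rewrite -natrM ler_nat.
Unshelve. all: by end_near. Qed.

Lemma mean_zero_average x : mean_zero x ->
  average x N @[N --> \oo] --> (0 : C^o).
Proof.
move=> x0.
apply: (proj2 (@cvgr0Pnorm_le C C^o nat \oo _ (average x))) => eps eps0.
have epsE : eps = (complex.Re eps)%:C.
  by apply/esym/RRe_real; rewrite ger0_real // ltW.
have re0 : 0 < complex.Re eps by rewrite -ltcR -epsE.
pose T := (Num.truncn (complex.Re eps)^-1).+1.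
have Teps : T%:R^-1 <= eps.
  rewrite epsE -[T%:R](rmorph_nat (@real_complex R)) -fmorphV lecR.
  by rewrite invf_ple ?posrE ?invr_gt0// ?ltr0n// ltW// truncnS_gt.
apply: filterS2 (x0 T isT) (nbhs_infty_ge 1) => N hN N1.
apply: le_trans Teps; rewrite /average normrM normfV normr_nat.
have NN : 0 < N%:R :> C by rewrite ltr0n.
by rewrite ler_pdivrMl// ler_pdivlMr ?ltr0n// mulrC.
Qed.

(** The geometric sums are bounded by 2 / |1 - e t|. *)
Lemma mean_zero_geometric (t : R) : e t != 1 ->
  mean_zero (fun n => e (n%:R * t)).
Proof.
move=> et1 T T0.
have pow n : e (n%:R * t) = e t ^+ n.
  elim: n => [|n IHn]; first by rewrite mul0r e0.
  by rewrite -natr1 mulrDl mul1r eD IHn exprSr.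
pose d := complex.Re `|e t - 1|.
have dE : d%:C = `|e t - 1| by apply: RRe_real; rewrite normr_real.
have d0 : 0 < d by rewrite -ltcR dE normr_gt0 subr_eq0.
pose B := (Num.truncn (d^-1 * (T * 2)%N%:R)).+1.
apply: filterS (nbhs_infty_ge B) => N BN.
rewrite (eq_bigr (fun i : 'I_N => e t ^+ i)) => [|i _]; last exact: pow.
have h : `|e t - 1| * `|\sum_(i < N) e t ^+ i| <= 2.
  rewrite -normrM -subrX1 (le_trans (ler_normB _ _))// normr1 normrX norm_e.
  by rewrite expr1n.
rewrite -(ler_pM2l (x := `|e t - 1|)) ?normr_gt0 ?subr_eq0// mulrCA.
apply: le_trans (ler_wpM2l (ler0n _ _) h) _.
rewrite -dE -(rmorph_nat (@real_complex R)) -(rmorph_nat (@real_complex R) 2).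
rewrite -[N%:R](rmorph_nat (@real_complex R)) -!rmorphM /= lecR.
rewrite -ler_pdivrMl//; apply: le_trans (ltW (truncnS_gt _)) _.
by rewrite ler_nat.
Qed.

End Means.

(** * Bessel's inequality and finite kernels *)

Section Kernel.
Variable R : realType.
Local Notation C := R[i].
Implicit Types (S : finType) (N K T : nat).

(** Bessel's inequality for T^2 almost orthogonal functions, combined with
    Cauchy-Schwarz: a bounded x correlates with them by 2 / T on average. *)
Lemma bessel (I : finType) T N (x : nat -> C) (f : I -> nat -> C) :
  #|I| = (T ^ 2)%N -> (0 < T)%N ->
  (forall n, `|x n| <= 1) -> (forall i n, `|f i n| <= 1) ->
  (forall i j, i != j ->
     (T ^ 2)%:R * `|\sum_(n < N) f i n * (f j n)^*%R| <= N%:R) ->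
  \sum_i `|\sum_(n < N) x n * f i n| <= (2 * T * N)%:R.
Proof.
move=> cardI T0 x1 f1 orth.
pose z i := \sum_(n < N) x n * f i n.
(* A unimodular (or, if z i = 0, null) factor that makes w i * z i = |z i|. *)
pose w i := `|z i| / z i.
have w1 i : `|w i| <= 1.
  rewrite /w normrM normfV normr_id; have [->|nz] := eqVneq (z i) 0.
    by rewrite normr0 mul0r.
  by rewrite divff ?normr_eq0.
have wz i : `|z i| = w i * z i.
  have [h|nz] := eqVneq (z i) 0; last by rewrite /w divfK.
  by rewrite h normr0 mulr0.
clearbody w.
pose y n := \sum_i w i * f i n.
have zy : \sum_i `|z i| = \sum_(n < N) x n * y n.
  under eq_bigr => i _ do rewrite wz mulr_sumr.
  rewrite exchange_big /=; apply: eq_bigr => n _.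
  by rewrite mulr_sumr; apply: eq_bigr => i _; rewrite mulrCA.
pose G i j := \sum_(n < N) f i n * (f j n)^*%R.
have yG : \sum_(n < N) `|y n| ^+ 2 = \sum_i \sum_j w i * (w j)^*%R * G i j.
  transitivity (\sum_(n < N) \sum_i \sum_j
                  w i * (w j)^*%R * (f i n * (f j n)^*%R)).
    apply: eq_bigr => n _; rewrite normCK rmorph_sum mulr_suml.
    apply: eq_bigr => i _; rewrite mulr_sumr; apply: eq_bigr => j _.
    by rewrite rmorphM mulrACA.
  rewrite exchange_big /=; apply: eq_bigr => i _.
  rewrite exchange_big /=; apply: eq_bigr => j _.
  by rewrite -mulr_sumr.
have T2 : 0 < (T ^ 2)%:R :> C by rewrite ltr0n expn_gt0 T0.
have sumG : \sum_i \sum_j `|G i j| <= (2 * T ^ 2 * N)%:R.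
  rewrite -(ler_pM2l T2) mulr_sumr.
  apply: (@le_trans _ _ (\sum_(i : I) (2 * T ^ 2 * N)%:R)); last first.
    by rewrite sumr_const cardI -[_ *+ (T ^ 2)]mulr_natl.
  apply: ler_sum => i _; rewrite mulr_sumr (bigD1 i) //=.
  have -> : (2 * T ^ 2 * N = T ^ 2 * N + T ^ 2 * N)%N by lia.
  rewrite natrD lerD //.
    rewrite (natrM _ (T ^ 2) N) ler_wpM2l ?ler0n//.
    apply: le_trans (norm_sum_le1 _) _; last by rewrite card_ord.
    by move=> n; rewrite normrM norm_conjC mulr_ile1.
  apply: (@le_trans _ _ (\sum_(j : I | j != i) N%:R)).
    by apply: ler_sum => j ji; apply: orth; rewrite eq_sym.
  rewrite sumr_const -[_ *+ _]mulr_natr -natrM ler_nat mulnC leq_mul2r.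
  by apply/orP; right; rewrite -cardI; apply: max_card.
have y2 : \sum_(n < N) `|y n| ^+ 2 <= (2 * T ^ 2 * N)%:R.
  apply: le_trans sumG; rewrite -[leLHS]ger0_norm; last first.
    by apply: sumr_ge0 => n _; rewrite exprn_ge0.
  rewrite yG; apply: le_trans (ler_norm_sum _ _ _) _; apply: ler_sum => i _.
  apply: le_trans (ler_norm_sum _ _ _) _; apply: ler_sum => j _.
  by rewrite !normrM norm_conjC ler_piMl// mulr_ile1.
have zy_le : \sum_i `|z i| <= \sum_(n < N) `|y n|.
  rewrite -[leLHS]ger0_norm ?sumr_ge0// zy.
  apply: le_trans (ler_norm_sum _ _ _) _; apply: ler_sum => n _.
  by rewrite normrM ler_piMl.
apply: le_trans zy_le _.
(* Cauchy-Schwarz in the form 2 T |y| <= |y|^2 + T^2, without square roots. *)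
have TT : 0 < (2 * T)%:R :> C by rewrite ltr0n muln_gt0.
rewrite -(ler_pM2l TT) mulr_sumr.
apply: (@le_trans _ _ (\sum_(n < N) (`|y n| ^+ 2 + T%:R ^+ 2))).
  apply: ler_sum => n _; rewrite natrM -mulrA mulr_natl mulrC.
  by apply: real_leif_mean_square_scaled; rewrite ?normr_real ?realn.
rewrite big_split /= sumr_const card_ord.
apply: le_trans (lerD y2 (lexx _)) _.
by rewrite -natrX -mulrnA -natrD -natrM ler_nat; nia.
Qed.

(** The finiteness of the k-kernel, in the form of an indexed family; this
    keeps the number of sequences explicit, and bounded uniformly in l when k
    is replaced by k^l. *)
Definition kernel_closed k S (f : S -> nat -> C) := forall s d, (d < k)%N ->
  exists s', forall m, f s (k * m + d)%N = f s' m.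

Lemma kernel_closedX k l S (f : S -> nat -> C) : (0 < k)%N ->
  kernel_closed k f -> kernel_closed (k ^ l) f.
Proof.
move=> k0 fk; elim: l => [|l IHl] s d dk.
  exists s => m; congr (f s _); move: dk; rewrite expn0 ltnS leqn0 => /eqP ->.
  by rewrite mul1n addn0.
have [s1 hs1] := fk s (d %% k)%N (ltn_pmod d k0).
have [|s2 hs2] := IHl s1 (d %/ k)%N.
  by rewrite ltn_divLR // -expnSr.
exists s2 => m; rewrite -hs2 -hs1; congr (f s _).
rewrite mulnDr addnAC -addnA [(_ %% _ + _)%N]addnC mulnA -expnS.
by rewrite [(k * (d %/ k))%N]mulnC -divn_eq.
Qed.

Lemma kernel_map K S (f : S -> nat -> C) : kernel_closed K f ->
  {sigma : S -> 'I_K -> S |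
     forall s (r : 'I__) m, f s (K * m + r)%N = f (sigma s r) m}.
Proof.
move=> fK.
have /choice [h hP] : forall sr : S * 'I_K, exists s',
    forall m, f sr.1 (K * m + sr.2)%N = f s' m.
  by case=> s r; apply: fK.
by exists (fun s r => h (s, r)) => s r m; rewrite -(hP (s, r)).
Qed.

(** The subsequences of g along the classes mod K = T^2 are almost orthogonal,
    while those of f s are drawn from a family of fixed size, and each of its
    members correlates with few of them. *)
Lemma mean_zero_orthogonal k S (f : S -> nat -> C) (g : nat -> C) :
  (1 < k)%N -> kernel_closed k f -> (forall s n, `|f s n| <= 1) ->
  (forall n, `|g n| <= 1) ->
  (forall K r r', (0 < K)%N -> r <> r' ->
     mean_zero (fun m => g (K * m + r)%N * (g (K * m + r')%N)^*%R)) ->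
  forall s, mean_zero (fun n => f s n * g n).
Proof.
move=> k1 fk f1 g1 orth s.
apply: mean_zero_blocks => [n|T T0]; first by rewrite normrM mulr_ile1.
have k0 := ltnW k1.
(* Any exponent with k^j >= 2 |S| T; the modulus K = T1^2 is a power of k. *)
pose j := (2 * #|S| * T)%N; pose T1 := (k ^ j)%N.
have T1j : (2 * #|S| * T <= T1)%N by apply/ltnW/ltn_expl.
have T10 : (0 < T1)%N by rewrite expn_gt0 k0.
have KE : (T1 ^ 2 = k ^ (j * 2))%N by rewrite -expnM.
exists (T1 ^ 2)%N; first by rewrite expn_gt0 T10.
have [sigma sigmaP] : {sigma : S -> 'I_(T1 ^ 2) -> S |
     forall s (r : 'I__) m, f s (T1 ^ 2 * m + r)%N = f (sigma s r) m}.
  by apply: kernel_map; rewrite KE; apply: kernel_closedX.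
pose phi (r : 'I_(T1 ^ 2)) m := g (T1 ^ 2 * m + r)%N.
have : \forall N \near \oo, forall rr : 'I_(T1 ^ 2) * 'I_(T1 ^ 2),
    rr.1 != rr.2 ->
    (T1 ^ 2)%:R * `|\sum_(n < N) phi rr.1 n * (phi rr.2 n)^*%R| <= N%:R.
  apply: filter_forall => -[r r'] /=.
  have [->|rr'] := eqVneq r r'; first by apply: filterE => N.
  have T120 : (0 < T1 ^ 2)%N by rewrite expn_gt0 T10.
  have rr'n : nat_of_ord r <> r' by move=> h; case/eqP: rr'; apply: val_inj.
  by apply: filterS (orth _ _ _ T120 rr'n _ T120) => N h _.
apply: filterS => N orthN.
have bes s' : \sum_r `|\sum_(m < N) f s' m * phi r m| <= (2 * T1 * N)%:R.
  apply: bessel => //; first by rewrite card_ord.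
  - by move=> i n; apply: g1.
  - by move=> r r' rr'; apply: (orthN (r, r')).
rewrite (sum_residues _ _ (fun n => f s n * g n)).
have h : `|\sum_(r < T1 ^ 2) \sum_(m < N)
     f s (T1 ^ 2 * m + r)%N * g (T1 ^ 2 * m + r)%N| <= (#|S| * (2 * T1 * N))%:R.
  apply: (@le_trans _ _
    (\sum_(s' : S) \sum_r `|\sum_(m < N) f s' m * phi r m|)); last first.
    apply: (@le_trans _ _ (\sum_(s' : S) (2 * T1 * N)%:R)).
      by apply: ler_sum.
    by rewrite sumr_const -mulrnA mulnC.
  apply: le_trans (ler_norm_sum _ _ _) _.
  rewrite exchange_big /=; apply: ler_sum => r _.
  under eq_bigr => m _ do rewrite sigmaP.
  by rewrite (bigD1 (sigma s r)) //= lerDl sumr_ge0.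
apply: le_trans (ler_wpM2l (ler0n _ _) h) _.
by rewrite -natrM ler_nat expnS expn1; nia.
Qed.

(** On each of the J windows of length K, f s is a combination, with bounded
    coefficients, of the indicators of the fibres of sigma s, which do not
    depend on the window. *)
Lemma norm_sum_windows K J S (f : S -> nat -> C) (sigma : S -> 'I_K -> S)
    (beta : R) s :
  (forall s n, `|f s n| <= 1) ->
  (forall s (r : 'I__) m, f s (K * m + r)%N = f (sigma s r) m) ->
  `|\sum_(n < K * J) f s n * e (n%:R * beta)| <=
    J%:R * \sum_(s' : S)
      `|\sum_(m < K) (sigma s m == s')%:R * e (m%:R * beta)|.
Proof.
move=> f1 sigmaP.
rewrite (sum_residues _ _ (fun n => f s n * e (n%:R * beta))) exchange_big /=.
apply: le_trans (ler_norm_sum _ _ _) _.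
rewrite -[X in _ <= X%:R * _]card_ord mulr_natl -sumr_const.
apply: ler_sum => j _.
have -> : \sum_(r < K) f s (K * j + r)%N * e ((K * j + r)%:R * beta) =
    \sum_(s' : S) f s' j * e ((K * j)%:R * beta) *
      \sum_(m < K) (sigma s m == s')%:R * e (m%:R * beta).
  under [RHS]eq_bigr => s' _ do rewrite mulr_sumr.
  rewrite exchange_big /=; apply: eq_bigr => r _.
  rewrite (bigD1 (sigma s r)) //= eqxx big1 => [|s' ss']; last first.
    by rewrite eq_sym (negbTE ss') mul0r mulr0.
  by rewrite sigmaP natrD mulrDl eD addr0 mul1r mulrA.
apply: le_trans (ler_norm_sum _ _ _) _; apply: ler_sum => s' _.
by rewrite !normrM norm_e mulr1 ler_piMl.
Qed.

Lemma irrational_mulz (x : R) (z : int) : z != 0 -> irrational x ->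
  irrational (z%:~R * x).
Proof.
move=> z0 irx [q _ qE]; apply: irx; exists (q / z%:~R) => //.
rewrite fmorph_div /= ratr_int qE mulrC mulKf //.
by rewrite intr_eq0.
Qed.

Lemma irrational_e_neq1 (x : R) : irrational x -> e x != 1.
Proof.
move=> irx; apply/eqP => /e_eq1_int [z zE]; apply: irx.
by exists z%:~R => //; rewrite ratr_int.
Qed.

End Kernel.

(** * Linear phases *)

Section Linear.
Variable R : realType.
Local Notation C := R[i].
Implicit Types (S : finType).

(** The subsequence along the class of r mod K1 has the frequency K1 alpha, and
    norm_sum_windows applies to it. The sum over all pairs of states makes the
    bound independent of r and s. *)
Lemma norm_sum_two_windows K1 K J S (f : S -> nat -> C)
    (sigma1 : S -> 'I_K1 -> S) (sigma : S -> 'I_K -> S) (alpha : R) s :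
  (forall s n, `|f s n| <= 1) ->
  (forall s (r : 'I__) m, f s (K1 * m + r)%N = f (sigma1 s r) m) ->
  (forall s (r : 'I__) m, f s (K * m + r)%N = f (sigma s r) m) ->
  `|\sum_(n < K1 * (K * J)) f s n * e (n%:R * alpha)| <=
    (K1 * J)%:R * \sum_(c : S * S)
      `|\sum_(m < K) (sigma c.1 m == c.2)%:R * e (m%:R * (K1%:R * alpha))|.
Proof.
move=> f1 sigma1P sigmaP.
rewrite (sum_residues _ _ (fun n => f s n * e (n%:R * alpha))).
apply: le_trans (ler_norm_sum _ _ _) _.
rewrite natrM -mulrA -[X in _ <= X%:R * _]card_ord mulr_natl -sumr_const.
apply: ler_sum => r _.
have -> : \sum_(m < K * J) f s (K1 * m + r)%N * e ((K1 * m + r)%:R * alpha) =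
    e (r%:R * alpha) *
    \sum_(m < K * J) f (sigma1 s r) m * e (m%:R * (K1%:R * alpha)).
  rewrite mulr_sumr; apply: eq_bigr => m _.
  rewrite sigma1P mulrCA -eD; congr (_ * e _).
  by rewrite natrD natrM; ring.
rewrite normrM norm_e mul1r.
apply: le_trans (norm_sum_windows _ _ _ f1 sigmaP) _.
rewrite ler_wpM2l ?ler0n//.
pose F s1 s2 : C := `|\sum_(m < K) (sigma s1 m == s2)%:R *
  e (m%:R * (K1%:R * alpha))|.
rewrite -/(F _ _) -(pair_bigA _ F) [leRHS](bigD1 (sigma1 s r)) //= lerDl.
by apply: sumr_ge0 => ? _; apply: sumr_ge0 => ? _; apply: normr_ge0.
Qed.

(** For each l, splitting off the last l digits bounds the sum by correlations,
    over a window of length k^t, of indicators of states with the frequency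
    k^l alpha. The frequencies are asymptotically orthogonal, and the number
    of indicators does not depend on t; hence the average over l < L of these
    correlations is small by Bessel's inequality. *)
Lemma mean_zero_linear k S (f : S -> nat -> C) (alpha : R) :
  (1 < k)%N -> kernel_closed k f -> (forall s n, `|f s n| <= 1) ->
  irrational alpha -> forall s, mean_zero (fun n => f s n * e (n%:R * alpha)).
Proof.
move=> k1 fk f1 ira s.
apply: mean_zero_blocks => [n|T T0]; first by rewrite normrM norm_e mulr1.
have k0 := ltnW k1.
have S0 : (0 < #|S|)%N by apply/card_gt0P; exists s.
(* Bessel's inequality gains 2 / T1 for each of the pairs of states. *)
pose T1 := (2 * #|{: S * S}| * T)%N.
have T10 : (0 < T1)%N by rewrite !muln_gt0 /= card_prod muln_gt0 S0 T0.
pose L := (T1 ^ 2)%N.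
have L0 : (0 < L)%N by rewrite expn_gt0 T10.
pose phi (l : 'I_L) m : C := e (m%:R * ((k ^ l)%:R * alpha)).
have : \forall N \near \oo, forall ll : 'I_L * 'I_L, ll.1 != ll.2 ->
    (T1 ^ 2)%:R * `|\sum_(n < N) phi ll.1 n * (phi ll.2 n)^*%R| <= N%:R.
  apply: filter_forall => -[i j] /=.
  have [->|ij] := eqVneq i j; first by apply: filterE => N.
  pose z : int := (k ^ i)%:Z - (k ^ j)%:Z.
  have z0 : z != 0 by rewrite subr_eq0 eqz_nat eqn_exp2l.
  have ne1 : e (z%:~R * alpha) != 1 :> C.
    by apply: irrational_e_neq1; apply: irrational_mulz.
  apply: filterS (mean_zero_geometric ne1 L0) => N h _.
  rewrite (eq_bigr (fun n : 'I_N => e (n%:R * (z%:~R * alpha)))) // => n _.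
  by rewrite /phi conj_e -eD /z intrB !pmulrn; congr e; ring.
case=> t _ /(_ (k ^ t)%N (ltnW (ltn_expl _ k1))) orth.
exists (k ^ (t + L))%N; first by rewrite expn_gt0 k0.
apply: filterE => J.
have [sigma sigmaP] := kernel_map (kernel_closedX (l := t) k0 fk).
pose D (l : 'I_L) (c : S * S) :=
  `|\sum_(m < k ^ t) (sigma c.1 m == c.2)%:R * phi l m|.
have bes c : \sum_l D l c <= (2 * T1 * k ^ t)%:R.
  (* The indicator, extended by 0 beyond the window. *)
  pose x m : C := if insub m is Some r then (sigma c.1 r == c.2)%:R else 0.
  have DE l : D l c = `|\sum_(m < k ^ t) x m * phi l m|.
    by congr `|_|; apply: eq_bigr => m _; rewrite /x valK.
  under eq_bigr => l _ do rewrite DE.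
  apply: bessel => //; first by rewrite card_ord.
  - rewrite /x => m; case: insubP => [r _ _|_]; last by rewrite normr0.
    by rewrite normr_nat; case: eqP.
  - by move=> i n; rewrite norm_e.
  - by move=> i j ij; apply: (orth (i, j)).
set A := `|_|.
have AD (l : 'I_L) : A <= (k ^ L * J)%:R * \sum_c D l c.
  have [sigma1 sigma1P] := kernel_map (kernel_closedX (l := l) k0 fk).
  have := norm_sum_two_windows (k ^ (L - l) * J) alpha s f1 sigma1P sigmaP.
  have lL : (l <= L)%N := ltnW (ltn_ord l).
  rewrite !mulnA -!expnD (subnKC lL).
  by rewrite (addnC l) -addnA (subnKC lL).
have LA : L%:R * A <= (k ^ L * J)%:R * (#|{: S * S}| * (2 * T1 * k ^ t))%:R.
  rewrite mulr_natl -[in X in X <= _](card_ord L) -sumr_const.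
  apply: le_trans (ler_sum _ (fun l _ => AD l)) _.
  rewrite -mulr_sumr ler_wpM2l ?ler0n// exchange_big /=.
  apply: (@le_trans _ _ (\sum_(c : S * S) (2 * T1 * k ^ t)%:R)).
    by apply: ler_sum => c _; exact: bes.
  by rewrite sumr_const -mulrnA mulnC.
pose q := (2 * #|{: S * S}|)%N.
have qT1 : 0 < (q * T1)%:R :> C.
  by rewrite ltr0n muln_gt0 T10 andbT muln_gt0 card_prod muln_gt0 S0.
rewrite -(ler_pM2l qT1) mulrA -!natrM.
have -> : (q * T1 * T = L)%N by rewrite /L /T1 /q; nia.
apply: le_trans LA _; rewrite -natrM ler_nat expnD.
by rewrite /q; apply: eq_leq; nia.
Qed.

Lemma periodic_modn (g : nat -> C) Q : (forall n, g (n + Q)%N = g n) ->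
  forall m n, m = n %[mod Q] -> g m = g n.
Proof.
move=> gQ.
have gmod n : g n = g (n %% Q)%N.
  rewrite {1}(divn_eq n Q) addnC; elim: (n %/ Q)%N => [|j IHj].
    by rewrite addn0.
  by rewrite mulSn [(Q + _)%N]addnC addnA gQ.
by move=> m n mn; rewrite (gmod m) mn -gmod.
Qed.

(** Multiplication by a periodic sequence preserves the finiteness of the
    kernel, provided the affine changes of variable n |-> u n + v (mod Q) of
    the periodic factor join the index set. *)
Lemma kernel_closed_twist k S (f : S -> nat -> C) (g : nat -> C) Q :
  (0 < Q)%N -> (forall n, g (n + Q)%N = g n) -> kernel_closed k f ->
  kernel_closed k (fun (x : S * 'I_Q * 'I_Q) n =>
    f x.1.1 n * g (x.1.2 * n + x.2)%N).
Proof.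
move=> Q0 gQ fk [[s u] v] d dk /=; have [s' s'P] := fk s d dk.
pose red a := Ordinal (ltn_pmod a Q0).
exists (s', red (u * k)%N, red (u * d + v)%N) => m /=.
rewrite s'P; congr (_ * _); apply: periodic_modn gQ _ _ _.
by rewrite modnDmr -[RHS]modnDml modnMml modnDml mulnDr mulnA addnA.
Qed.

End Linear.

(** * Rational and irrational coefficients *)

Section Rational.
Variable R : realType.
Implicit Types (x y : R) (p q : {poly R}).

Lemma rationalD x y : rational x -> rational y -> rational (x + y).
Proof. by move=> [a _ <-] [b _ <-]; exists (a + b); rewrite ?rmorphD. Qed.

Lemma rationalM x y : rational x -> rational y -> rational (x * y).
Proof. by move=> [a _ <-] [b _ <-]; exists (a * b); rewrite ?rmorphM. Qed.

Lemma rationalN x : rational x -> rational (- x).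
Proof. by move=> [a _ <-]; exists (- a); rewrite ?rmorphN. Qed.

Lemma rational_nat n : rational (n%:R : R).
Proof. by exists n%:R; rewrite ?ratr_nat. Qed.

Lemma rational_sum (I : Type) (r : seq I) (P : pred I) (F : I -> R) :
  (forall i, P i -> rational (F i)) -> rational (\sum_(i <- r | P i) F i).
Proof.
move=> FP; apply: big_ind => //; last exact: rationalD.
exact: (rational_nat 0).
Qed.

Lemma rational_denominator x : rational x ->
  exists2 D, (0 < D)%N & x * D%:R \is a Num.int.
Proof.
move=> [a _ <-]; exists `|denq a|%N; first by rewrite absz_gt0 denq_neq0.
have -> : `|denq a|%:R = (denq a)%:~R :> R.
  by rewrite -[RHS]/(_%:~R) -{2}(gez0_abs (ltW (denq_gt0 a))) pmulrn.
by rewrite /ratr mulfVK ?intr_eq0 ?denq_neq0// intr_int.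
Qed.

(** With Q a common denominator of the coefficients of q, the difference
    q(n + Q) - q(n) is an integer, since Q divides (n + Q)^i - n^i. *)
Lemma rational_poly_period q : (forall i, (0 < i)%N -> rational q`_i) ->
  exists2 Q, (0 < Q)%N & forall n, e q.[(n + Q)%:R] = e q.[n%:R].
Proof.
move=> qrat.
have /choice [D DP] : forall i, exists D,
    (0 < D)%N /\ ((0 < i)%N -> q`_i * D%:R \is a Num.int).
  case=> [|i]; first by exists 1%N.
  by have [D D0 Dint] := rational_denominator (qrat i.+1 isT); exists D.
exists (\prod_(i < size q) D i)%N.
  by apply: prodn_gt0 => i; have [] := DP i.
set Q := (\prod_(i < _) _)%N => n.
suff /intrP [z zE] : q.[(n + Q)%:R] - q.[n%:R] \is a Num.int.
  by rewrite -[q.[(n + Q)%:R]](subrK q.[n%:R]) zE eD e_int mul1r.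
rewrite !horner_coef -sumrB; apply: rpred_sum => -[[|i] ilt] _ /=.
  by rewrite !expr0 subrr rpred0.
rewrite -mulrBr subrXX natrD [_ + Q%:R]addrC addrK mulrA rpredM//; last first.
  apply: rpred_sum => j _; apply: rpredM; apply: rpredX => //.
    by rewrite -natrD natr_int.
  by rewrite natr_int.
rewrite /Q (bigD1 (Ordinal ilt)) //= natrM mulrA rpredM ?natr_int//.
by have [_ ->] := DP i.+1.
Qed.

Lemma coef_affine_exp (K r : R) i j :
  ((K *: 'X + r%:P) ^+ i)`_j = K ^+ j * r ^+ (i - j) *+ 'C(i, j).
Proof.
have term t : (r%:P ^+ (i - t) * (K *: 'X) ^+ t *+ 'C(i, t))`_j =
    (j == t)%:R * (K ^+ t * r ^+ (i - t) *+ 'C(i, t)).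
  rewrite coefMn -polyC_exp exprZn coefCM coefZ coefXn [RHS]mulrnAr.
  by congr (_ *+ _); rewrite mulrA mulrC; congr (_ * _); exact: mulrC.
rewrite addrC exprDn coef_sum; under eq_bigr => t _ do rewrite term.
have [ij|ji] := ltnP i j.
  rewrite bin_small// mulr0n big1 // => t _.
  by rewrite gtn_eqF ?mul0r// (leq_trans _ ij).
rewrite (bigD1 (Ordinal (ji : j < i.+1)%N)) //= eqxx mul1r big1 ?addr0//
  => t tj.
case: eqP => [jt|_]; last by rewrite mul0r.
by case/eqP: tj; apply: val_inj.
Qed.

Definition affine_diff p (K r r' : nat) : {poly R} :=
  (p \Po (K%:R *: 'X + r%:R%:P)) - (p \Po (K%:R *: 'X + r'%:R%:P)).

Lemma horner_affine_diff p K r r' m :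
  (affine_diff p K r r').[m%:R] = p.[(K * m + r)%:R] - p.[(K * m + r')%:R].
Proof.
by rewrite /affine_diff !(hornerE, horner_comp) !natrD !natrM.
Qed.

Lemma coef_affine_diff p K r r' j :
  (affine_diff p K r r')`_j = \sum_(i < size p)
    p`_i * (K%:R ^+ j * (r%:R ^+ (i - j) - r'%:R ^+ (i - j)) *+ 'C(i, j)).
Proof.
rewrite coefB !coef_comp_poly -sumrB; apply: eq_bigr => i _.
by rewrite !coef_affine_exp -mulrBr -mulrnBl -mulrBr.
Qed.

Lemma rational_affine_diff_term p K r r' i j :
  ((j < i)%N -> rational p`_i) ->
  rational
    (p`_i * (K%:R ^+ j * (r%:R ^+ (i - j) - r'%:R ^+ (i - j)) *+ 'C(i, j))).
Proof.
have [ij _|ji rat_i] := leqP i j.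
  have -> : (i - j = 0)%N by apply/eqP; rewrite subn_eq0.
  by rewrite !expr0 subrr mulr0 mul0rn mulr0; exact: (rational_nat 0).
apply: rationalM; first exact: rat_i.
rewrite -mulr_natr -!natrX; apply: rationalM; last exact: rational_nat.
apply: rationalM; first exact: rational_nat.
by apply: rationalD; [|apply: rationalN]; exact: rational_nat.
Qed.

Lemma rational_affine_diff p d K r r' :
  (forall i, (d < i)%N -> rational p`_i) ->
  forall j, (d <= j)%N -> rational (affine_diff p K r r')`_j.
Proof.
move=> rat_p j dj; rewrite coef_affine_diff.
apply: rational_sum => i _; apply: rational_affine_diff_term => ji.
by apply: rat_p; apply: leq_ltn_trans dj ji.
Qed.

(** The term in x^d comes from p_(d+1) and equals
    (d + 1) K^d (r - r') p_(d+1), up to rational contributions. *)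
Lemma irrational_affine_diff p d K r r' :
  irrational p`_d.+1 -> (forall i, (d.+1 < i)%N -> rational p`_i) ->
  (0 < K)%N -> r <> r' -> irrational (affine_diff p K r r')`_d.
Proof.
move=> irr_p rat_p K0 rr'.
have dp : (d.+1 < size p)%N.
  rewrite ltnNge; apply/negP => /leq_sizeP/(_ _ (leqnn _)) pd0.
  by apply: irr_p; rewrite pd0; exact: (rational_nat 0).
rewrite coef_affine_diff (bigD1 (Ordinal dp)) //=.
set B := \sum_(i < _ | _) _.
have ratB : rational B.
  apply: rational_sum => i i_d; apply: rational_affine_diff_term => di.
  apply: rat_p; rewrite ltn_neqAle di andbT eq_sym.
  by apply: contra i_d => /eqP h; apply/eqP/val_inj.
pose z : int := ((K ^ d * d.+1)%:Z * (r%:Z - r'%:Z))%R.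
have z0 : z != 0.
  rewrite mulf_neq0// ?subr_eq0 ?eqz_nat; last by apply/eqP.
  by rewrite muln_eq0 negb_or -lt0n expn_gt0 K0.
have -> : p`_d.+1 * (K%:R ^+ d * (r%:R ^+ (d.+1 - d) - r'%:R ^+ (d.+1 - d))
    *+ 'C(d.+1, d)) = z%:~R * p`_d.+1.
  rewrite subSnn !expr1 binSn /z intrM intrB -!pmulrn natrM natrX.
  by rewrite -[X in _ * X = _]mulr_natr; ring.
move=> ratS; apply: (irrational_mulz z0 irr_p).
by rewrite -[_ * _](addrK B); apply: rationalD => //; apply: rationalN.
Qed.

End Rational.

(** * Polynomial phases and automatic sequences *)

Section Polynomial.
Variable R : realType.
Local Notation C := R[i].
Implicit Types (S : finType) (p : {poly R}).

(** Without its linear term, p has rational coefficients, except perhaps for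
    the constant one; so the phase of this part is periodic, and
    kernel_closed_twist absorbs it. *)
Lemma mean_zero_poly1 k S (f : S -> nat -> C) p s :
  (1 < k)%N -> kernel_closed k f -> (forall s n, `|f s n| <= 1) ->
  irrational p`_1 -> (forall i, (1 < i)%N -> rational p`_i) ->
  mean_zero (fun n => f s n * e p.[n%:R]).
Proof.
move=> k1 fk f1 irr_p rat_p.
pose q := p - p`_1 *: 'X.
have rat_q i : (0 < i)%N -> rational q`_i.
  move=> i0; rewrite /q coefB coefZ coefX; have [->|i1] := eqVneq i 1%N.
    by rewrite mulr1 subrr; exact: (rational_nat _ 0).
  by rewrite mulr0 subr0; apply: rat_p; rewrite ltn_neqAle eq_sym i1.
have [Q Q0 qQ] := rational_poly_period rat_q.
pose g n : C := e q.[n%:R].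
have twist := kernel_closed_twist Q0 (qQ : forall n, g (n + Q)%N = g n) fk.
pose red a := Ordinal (ltn_pmod a Q0).
have F1 (x : S * 'I_Q * 'I_Q) n : `|f x.1.1 n * g (x.1.2 * n + x.2)%N| <= 1.
  by rewrite normrM norm_e mulr1.
have := mean_zero_linear k1 twist F1 irr_p (s, red 1%N, red 0%N).
congr mean_zero; apply/funext => n /=.
have -> : g (1 %% Q * n + 0 %% Q)%N = g n.
  apply: periodic_modn (qQ : forall n, g (n + Q)%N = g n) _ _ _.
  by rewrite mod0n addn0 modnMml mul1n.
rewrite -mulrA -eD /q; congr (_ * e _).
by rewrite !hornerE; ring.
Qed.

(** Induction on the largest index d + 1 of an irrational coefficient: by
    mean_zero_orthogonal it suffices to treat, for a constant sequence, the
    polynomials p(K x + r) - p(K x + r'), for which this index is d. *)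
Lemma mean_zero_poly d k S (f : S -> nat -> C) p s :
  (1 < k)%N -> kernel_closed k f -> (forall s n, `|f s n| <= 1) ->
  irrational p`_d.+1 -> (forall i, (d.+1 < i)%N -> rational p`_i) ->
  mean_zero (fun n => f s n * e p.[n%:R]).
Proof.
move=> k1; elim: d S f p s => [|d IHd] S f p s fk f1 irr_p rat_p.
  exact: mean_zero_poly1 fk f1 irr_p rat_p.
apply: (mean_zero_orthogonal (g := fun n => e p.[n%:R]) k1 fk f1) => [n|].
  by rewrite norm_e.
move=> K r r' K0 rr'.
have := IHd unit (fun _ _ => 1) (affine_diff p K r r') tt.
have -> : (fun n : nat => 1 * e (affine_diff p K r r').[n%:R]) =
  (fun m => e p.[(K * m + r)%:R] * (e p.[(K * m + r')%:R])^*%R).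
  by apply/funext => m; rewrite mul1r conj_e -eD horner_affine_diff.
apply.
- by move=> [] e' _; exists tt.
- by move=> _ _; rewrite normr1.
- exact: irrational_affine_diff.
- by apply: rational_affine_diff.
Qed.

End Polynomial.

Section Automatic.
Local Open Scope nat_scope.
Variable k : nat.
Hypothesis k_gt1 : 1 < k.

Lemma digits_rec_fuel f f' n : n <= f -> n <= f' ->
  digits_rec k f n = digits_rec k f' n.
Proof.
elim: f f' n => [|f IHf] [|f'] n //=.
- by rewrite leqn0 => /eqP ->.
- by move=> _; rewrite leqn0 => /eqP ->.
move=> nf nf'; case: eqP => // /eqP n0; congr rcons.
have lt_n : n %/ k < n by rewrite ltn_Pdiv // lt0n.
by apply: IHf; rewrite -ltnS; apply: leq_trans lt_n _.
Qed.

Lemma digits_mulD m d : d < k -> 0 < k * m + d ->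
  digits k (k * m + d) = rcons (digits k m) d.
Proof.
move=> dk; rewrite /digits; case E : (k * m + d) => [|n] //= _.
have k0 := ltnW k_gt1.
have mE : n.+1 %/ k = m by rewrite -E mulnC divnMDl // divn_small // addn0.
rewrite mE -E mulnC modnMDl modn_small //; congr rcons.
apply: digits_rec_fuel => //; rewrite -ltnS -E.
by case: m E {mE} => [|m] E //; nia.
Qed.

Lemma expansion_mulD m (d : 'I_k) : 0 < k * m + d ->
  expansion k (k * m + d) = rcons (expansion k m) d.
Proof.
move=> md0; rewrite /expansion digits_mulD // -cats1 pmap_cat /= valK.
by rewrite cats1.
Qed.

(** Since expansions have no leading zeros, the values output (run s _) do not
    form a family that is closed under decimation: the relation fails at 0,
    where padding changes the state. So the second component of the index
    records the state after the last nonzero digit read, which is the state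
    whose output counts once the remaining number is 0. *)
Definition automaton_family (D : Type) (A : automaton k D)
    (x : state A * state A) (n : nat) : D :=
  if n == 0 then output x.2 else output (run x.1 (expansion k n)).

Lemma automaton_family_decimation (D : Type) (A : automaton k D) x d :
  d < k -> exists x', forall m,
    @automaton_family D A x (k * m + d) = @automaton_family D A x' m.
Proof.
case: x => s o dk; pose d' := Ordinal dk.
exists (trans s d', if d == 0 then o else trans s d') => m.
rewrite /automaton_family /=.
have [md0|md0] := posnP (k * m + d).
  have [m0 d0] : m = 0 /\ d = 0 by nia.
  by rewrite m0 d0.
rewrite (expansion_mulD (d := d')) //.
rewrite /run foldr_rcons; have [m0|//] := eqVneq m 0.
by rewrite m0 muln0 add0n in md0 *; rewrite /expansion /= gtn_eqF.
Qed.

End Automatic.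

Theorem corollary5p2 (R : realType) (k : nat) (a : nat -> R[i]) (p : {poly R}) :
  (2 <= k)%N ->
  automatic k a ->
  (exists i : nat, (0 < i)%N /\ irrational p`_i) ->
  average (fun n : nat => a n * e p.[n%:R]) N @[N --> \oo] --> (0 : R[i]^o).
Proof.
move=> k2 [A aA] [i0 [i0_gt0 irr_i0]].
have [d irr_d rat_d] : exists2 d, irrational p`_d.+1 &
    forall i, (d.+1 < i)%N -> rational p`_i.
  pose P i := (0 < i)%N && `[< irrational p`_i >].
  have exP : exists i, P i by exists i0; rewrite /P i0_gt0; apply/asboolP.
  have ubP i : P i -> (i <= size p)%N.
    move=> /andP[_ /asboolP irr_i]; rewrite leqNgt; apply/negP => size_i.
    apply: irr_i; rewrite nth_default ?(ltnW size_i)//.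
    exact: (rational_nat _ 0).
  have [[|d] /andP[// _ /asboolP irr_d] max_d] := ex_maxnP exP ubP.
  exists d => // i di; apply: contrapT => irr_i.
  have /max_d : P i by rewrite /P (leq_ltn_trans _ di)//; apply/asboolP.
  by rewrite leqNgt di.
(* Any positive bound for the outputs; the family is normalized by it. *)
pose B : R[i] := 1 + \sum_(s : state A) `|output s|.
have B0 : 0 < B by rewrite ltr_pwDl// sumr_ge0.
pose f x n := B^-1 * @automaton_family k _ A x n.
have output_le (s : state A) : `|output s| <= B.
  rewrite /B (bigD1 s) //= addrCA lerDl addr_ge0// sumr_ge0//.
have f1 x n : `|f x n| <= 1.
  rewrite normrM normfV (gtr0_norm B0) ler_pdivrMl// mulr1 /automaton_family.
  by case: ifP.
have fk : kernel_closed k f.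
  move=> x d' dk; have [x' xx'] := automaton_family_decimation k2 x dk.
  by exists x' => m; rewrite /f xx'.
have -> : (fun n => a n * e p.[n%:R]) =
    (fun n => B * (f (init A, init A) n * e p.[n%:R])).
  apply/funext => n; rewrite /f !mulrA divff ?gt_eqF// mul1r aA.
  by rewrite /automaton_family /=; case: eqP => [->|].
apply/mean_zero_average/mean_zeroZ.
exact: (mean_zero_poly (init A, init A) k2 fk f1 irr_d rat_d).
Qed.
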